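(* Let $(A,\rhd,\lhd)$ be a Leibniz-dendriform algebra, let $\{e_1,\dots,e_n\}$ be a basis of $A$ and $\{e_1^*,\dots,e_n^*\}$ its dual basis. Then $$r:=\sum_{i=1}^n(e_i^*\otimes e_i+e_i\otimes e_i^* )$$ is a symmetric solution of the classical Leibniz Yang–Baxter equation in the Leibniz algebra $A\ltimes_{L_\lhd^*,-L_\lhd^*-R_\rhd^*}A^*$. Moreover, $r$ is nondegenerate and the induced bilinear form $\mathcal B$ on $A\ltimes_{L_\lhd^*,-L_\lhd^*-R_\rhd^*}A^*$, $\mathcal B(X,Y)=\langle(r^\sharp)^{-1}(X),Y\rangle$, is given by $$\mathcal B(x+\xi,y+\eta)=\langle\xi,y\rangle+\langle\eta,x\rangle\qquad(x,y\in A,\ \xi,\eta\in A^* ).$$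
   Context: All vector spaces are finite-dimensional over an algebraically closed field $\mathbb K$ of characteristic $0$. A Leibniz algebra is a vector space with a bilinear operation satisfying $[x,[y,z]]=[[x,y],z]+[y,[x,z]]$. A Leibniz-dendriform algebra is a vector space $A$ with two bilinear operations $\rhd,\lhd$ such that for all $x,y,z\in A$: $(x\lhd y)\lhd z=x\lhd(y\lhd z)-y\lhd(x\lhd z)-(x\rhd y)\lhd z$; $x\lhd(y\rhd z)=(x\lhd y)\rhd z+y\rhd(x\lhd z)+y\rhd(x\rhd z)$; $x\rhd(y\rhd z)=(x\rhd y)\rhd z+y\lhd(x\rhd z)-x\rhd(y\lhd z)$. Then $A$ with $[x,y]_{\rhd,\lhd}=x\lhd y+x\rhd y$ is a Leibniz algebra. Put $L_\lhd(x)y=x\lhd y$, $R_\rhd(x)y=y\rhd x$, and for $\rho:A\to\mathfrak{gl}(A)$ let $\rho^*:A\to\mathfrak{gl}(A^* )$, $\langle\rho^*(x)\xi,y\rangle=-\langle\xi,\rho(x)y\rangle$. The Leibniz algebra $A\ltimes_{L_\lhd^*,-L_\lhd^*-R_\rhd^*}A^*$ is $A\oplus A^*$ with bracket $[x+\xi,y+\eta]=[x,y]_{\rhd,\lhd}+L_\lhd^*(x)\eta-L_\lhd^*(y)\xi-R_\rhd^*(y)\xi$. For a Leibniz algebra $\mathfrak h$ and $r\in\mathfrak h\otimes\mathfrak h$, $r^\sharp:\mathfrak h^*\to\mathfrak h$ is $\langle r^\sharp(\xi),\eta\rangle=\langle r,\xi\otimes\eta\rangle$; $r\in\mathrm{Sym}^2(\mathfrak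 h)$ is nondegenerate if $r^\sharp$ is an isomorphism. The classical Leibniz Yang–Baxter equation for $r\in\mathrm{Sym}^2(\mathfrak h)$ is $[[r,r]]=0$, where $\langle[[P,Q]],\xi_1\otimes\xi_2\otimes\xi_3\rangle=\langle\{P^\sharp,Q^\sharp\}(\xi_1,\xi_2),\xi_3\rangle$ and, for $f,g\in\mathrm{Hom}(\mathfrak h^*,\mathfrak h)$, $$\{f,g\}(\xi_1,\xi_2)=-f(L^*_{g\xi_1}\xi_2)+f(L^*_{g\xi_2}\xi_1)+f(R^*_{g\xi_2}\xi_1)+[g\xi_1,f\xi_2]_{\mathfrak h}+[f\xi_1,g\xi_2]_{\mathfrak h}-g(L^*_{f\xi_1}\xi_2)+g(L^*_{f\xi_2}\xi_1)+g(R^*_{f\xi_2}\xi_1),$$ with $\langle L_x^*\xi,y\rangle=-\langle\xi,[x,y]_{\mathfrak h}\rangle$, $\langle R_x^*\xi,y\rangle=-\langle\xi,[y,x]_{\mathfrak h}\rangle$. Here $\mathfrak h=A\oplus A^*$ and $\mathfrak h^*$ is identified with $A^*\oplus A$. *)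

(* Defs.v *)
From HB Require Import structures.
From mathcomp Require Import all_boot all_order all_algebra.
From mathcomp Require Import ring.

Set Implicit Arguments.
Unset Strict Implicit.
Unset Printing Implicit Defensive.

Import GRing.Theory.
Local Open Scope ring_scope.

Definition dual (K : fieldType) (V : vectType K) : vectType K := 'Hom(V, K^o).

Record leibnizAlgebra (K : fieldType) (h : vectType K) := LeibnizAlgebra {
  lbracket : {bilinear h -> h -> h};
  _ : forall x y z : h, lbracket x (lbracket y z) =
        lbracket (lbracket x y) z + lbracket y (lbracket x z)
}.

Record leibnizDendriform (K : fieldType) (A : vectType K) :=
  LeibnizDendriform {
  ld_rhd : {bilinear A -> A -> A};
  ld_lhd : {bilinear A -> A -> A};
  _ : forall x y z : A, ld_lhd (ld_lhd x y) z =
        ld_lhd x (ld_lhd y z) - ld_lhd y (ld_lhd x z) - ld_lhd (ld_rhd x y) z;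
  _ : forall x y z : A, ld_lhd x (ld_rhd y z) =
        ld_rhd (ld_lhd x y) z + ld_rhd y (ld_lhd x z) + ld_rhd y (ld_rhd x z);
  _ : forall x y z : A, ld_rhd x (ld_rhd y z) =
        ld_rhd (ld_rhd x y) z + ld_lhd y (ld_rhd x z) - ld_rhd x (ld_lhd y z)
}.

Fact linfun_linearE (K : fieldType) (U V : vectType K) (f : U -> V) :
  linear f -> linfun f =1 f.
Proof.
move=> linf; pose F : {linear U -> V} :=
  HB.pack f (GRing.isLinear.Build K U V *:%R f linf).
exact: (lfunE F).
Qed.

Section Separation.
Variables (K : fieldType) (V : vectType K).

Lemma dual_separates (u v : V) : (forall xi : dual V, xi u = xi v) -> u = v.
Proof.
move=> uv; rewrite (coord_vbasis (memvf u)) (coord_vbasis (memvf v)).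
apply: eq_bigr => i _; congr (_ *: _).
have := uv (linfun (coord (vbasis fullv) i : V -> K^o)).
by rewrite !lfunE.
Qed.

End Separation.

Section Translations.
Variables (K : fieldType) (V : vectType K).

Definition lmult (m : {bilinear V -> V -> V}) (x : V) : 'End(V) :=
  linfun (m x).

Definition rmult (m : {bilinear V -> V -> V}) (x : V) : 'End(V) :=
  linfun (applyr m x).

Lemma lmultE m x y : lmult m x y = m x y.
Proof. exact: lfunE. Qed.

Lemma rmultE m x y : rmult m x y = m y x.
Proof. exact: lfunE. Qed.

Definition dual_rep (rho : V -> 'End(V)) (x : V) : 'End(dual V) :=
  linfun (fun xi : dual V => (- (xi \o rho x))%VF).

Lemma dual_repE rho x (xi : dual V) y :
  dual_rep rho x xi y = - xi (rho x y).
Proof.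
pose F (xi : dual V) : dual V := (- (xi \o rho x))%VF.
have linF : linear F.
  move=> a u v; rewrite /F; apply/lfunP => w.
  by rewrite !(opp_lfunE, add_lfunE, scale_lfunE, comp_lfunE) opprD scalerN.
by rewrite /dual_rep (linfun_linearE linF) opp_lfunE comp_lfunE.
Qed.

End Translations.

Section SubAdjacent.
Variables (K : fieldType) (A : vectType K) (D : leibnizDendriform A).

Local Notation "x <| y" := (ld_lhd D x y) (at level 40).
Local Notation "x |> y" := (ld_rhd D x y) (at level 40).

Lemma ld_axiom1 x y z :
  (x <| y) <| z = x <| (y <| z) - y <| (x <| z) - (x |> y) <| z.
Proof. by case: D. Qed.

Lemma ld_axiom2 x y z :
  x <| (y |> z) = (x <| y) |> z + y |> (x <| z) + y |> (x |> z).
Proof. by case: D. Qed.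

Lemma ld_axiom3 x y z :
  x |> (y |> z) = (x |> y) |> z + y <| (x |> z) - x |> (y <| z).
Proof. by case: D. Qed.

Definition ld_bracket_fun (x y : A) : A := x <| y + x |> y.

Fact ld_bracket_bilinear : bilinear_for *:%R *:%R ld_bracket_fun.
Proof.
split=> u a v w; rewrite /ld_bracket_fun.
  by rewrite !linearPl /= scalerDr addrACA.
by rewrite !linearPr /= scalerDr addrACA.
Qed.

HB.instance Definition _ :=
  bilinear_isBilinear.Build K A A A *:%R *:%R ld_bracket_fun ld_bracket_bilinear.

Definition ld_bracket : {bilinear A -> A -> A} := ld_bracket_fun.

Lemma ld_bracketE x y : ld_bracket x y = x <| y + x |> y.
Proof. by []. Qed.

Fact ld_bracket_leibniz x y z : ld_bracket x (ld_bracket y z) =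
  ld_bracket (ld_bracket x y) z + ld_bracket y (ld_bracket x z).
Proof.
apply: dual_separates => xi.
rewrite !ld_bracketE !linearDl !linearDr /=.
rewrite ld_axiom1 (ld_axiom2 x y z) (ld_axiom3 x y z).
rewrite !(linearD, linearB, linearN) /=; ring.
Qed.

Definition ld_leibniz : leibnizAlgebra A := LeibnizAlgebra ld_bracket_leibniz.

Lemma ld_axiom23 x y z : (x <| y) |> z + (y |> x) |> z = 0.
Proof.
apply: (addIr (x <| (y |> z))); rewrite add0r [in RHS]ld_axiom2 ld_axiom3.
apply: dual_separates => xi; rewrite !(linearD, linearB, linearN) /=; ring.
Qed.

Local Notation lhd_dual := (dual_rep (lmult (ld_lhd D))).
Local Notation rhd_dual := (dual_rep (rmult (ld_rhd D))).

Definition ld_double_fun (X Y : (A * dual A)%type) : (A * dual A)%type :=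
  (ld_bracket X.1 Y.1,
   lhd_dual X.1 Y.2 - lhd_dual Y.1 X.2 - rhd_dual Y.1 X.2).

Lemma ld_double_fun2E X Y t : (ld_double_fun X Y).2 t =
  X.2 (Y.1 <| t) + X.2 (t |> Y.1) - Y.2 (X.1 <| t) :> K.
Proof.
rewrite /= !(add_lfunE, opp_lfunE, dual_repE, lmultE, rmultE) !opprK.
by rewrite -addrA addrC.
Qed.

Lemma pair_dualP (U V : (A * dual A)%type) :
  U.1 = V.1 -> (forall t, U.2 t = V.2 t :> K) -> U = V.
Proof. by case: U V => [u xi] [v eta] /= -> eqf; congr pair; apply/lfunP. Qed.

Fact ld_double_bilinear : bilinear_for *:%R *:%R ld_double_fun.
Proof.
have lin2E a (U V : (A * dual A)%type) t :
    (a *: U + V).2 t = a * U.2 t + V.2 t :> K.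
  by rewrite add_lfunE scale_lfunE.
have linE a (xi : dual A) u v : xi (a *: u + v) = a * xi u + xi v :> K.
  by rewrite linearP.
split=> U a V W; apply: pair_dualP => [|t].
- exact: linearPl.
- by rewrite lin2E !ld_double_fun2E !lin2E !linearPl /= !linE; ring.
- exact: linearPr.
- by rewrite lin2E !ld_double_fun2E !lin2E !linearPl !linearPr /= !linE; ring.
Qed.

HB.instance Definition _ :=
  bilinear_isBilinear.Build K (A * dual A)%type (A * dual A)%type
    (A * dual A)%type *:%R *:%R ld_double_fun ld_double_bilinear.

Definition ld_double_bracket :
  {bilinear (A * dual A)%type -> (A * dual A)%type -> (A * dual A)%type} :=
  ld_double_fun.

Lemma ld_double_bracket1E X Y :
  (ld_double_bracket X Y).1 = ld_bracket X.1 Y.1.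
Proof. by []. Qed.

Lemma ld_double_bracket2E X Y t : (ld_double_bracket X Y).2 t =
  X.2 (Y.1 <| t) + X.2 (t |> Y.1) - Y.2 (X.1 <| t) :> K.
Proof. exact: ld_double_fun2E. Qed.

Fact ld_double_leibniz X Y Z : ld_double_bracket X (ld_double_bracket Y Z) =
  ld_double_bracket (ld_double_bracket X Y) Z +
  ld_double_bracket Y (ld_double_bracket X Z).
Proof.
have add2E (U V : (A * dual A)%type) t :
    (U + V).2 t = U.2 t + V.2 t :> K by rewrite add_lfunE.
have addE (xi : dual A) u v : xi (u + v) = xi u + xi v :> K.
  by rewrite linearD.
have oppE (xi : dual A) u : xi (- u) = - xi u :> K by rewrite linearN.
apply: pair_dualP => [|t]; first exact: ld_bracket_leibniz.
rewrite add2E !ld_double_bracket2E !ld_double_bracket1E !ld_bracketE.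
move: X Y Z => [x xi] [y eta] [z zeta] /=.
rewrite !linearDl !linearDr /= !ld_axiom1 !ld_axiom2.
have -> : (z <| t) |> y = - ((t |> z) |> y).
  by apply/eqP; rewrite -addr_eq0 ld_axiom23.
by rewrite !(addE, oppE); ring.
Qed.

Definition ld_semidirect : leibnizAlgebra (A * dual A)%type :=
  LeibnizAlgebra ld_double_leibniz.

End SubAdjacent.

Section Curry.
Variables (K : fieldType) (U V W : vectType K).

Definition lfun2 (f : U -> V -> W) : 'Hom(U, 'Hom(V, W)) :=
  linfun (fun u => linfun (f u)).

Lemma lfun2E (f : U -> V -> W) :
  bilinear_for *:%R *:%R f -> forall u v, lfun2 f u v = f u v.
Proof.
move=> [linl linr] u v.
have linfE u0 v0 : linfun (f u0) v0 = f u0 v0 by exact: linfun_linearE.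
have linF : linear (fun u0 => linfun (f u0)).
  move=> a u1 u2; apply/lfunP => v0.
  by rewrite add_lfunE scale_lfunE !linfE linl.
by rewrite /lfun2 (linfun_linearE linF) linfE.
Qed.

End Curry.

(* Spaces being finite-dimensional, h (x) h and h (x) h (x) h are modelled by
   the bilinear, resp. trilinear, forms on the dual of h; the pairing
   <t, xi (x) eta> is then the evaluation t xi eta. [tens_universal] is the
   universal property of the tensor product. *)
Definition tensor2 (K : fieldType) (h : vectType K) : vectType K :=
  'Hom(dual h, dual (dual h)).

Definition tensor3 (K : fieldType) (h : vectType K) : vectType K :=
  'Hom(dual h, tensor2 h).

Section Tensor.
Variables (K : fieldType) (h : vectType K).
Implicit Types (x y : h) (xi eta : dual h) (t : tensor2 h).

Definition tens x y : tensor2 h := lfun2 (fun xi eta => xi x * eta y : K^o).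

Definition tensor_flip t : tensor2 h := lfun2 (fun xi eta => t eta xi).

Definition symmetric_tensor t := tensor_flip t = t.

Definition ev_dual : 'Hom(h, dual (dual h)) := lfun2 (fun x xi => xi x).

(* The inverse of the canonical isomorphism onto the bidual turns the form
   [t xi] on the dual into a vector; see [tensor_sharpE]. *)
Definition tensor_sharp t : 'Hom(dual h, h) := (ev_dual^-1 \o t)%VF.

Definition nondegenerate_tensor t := bijective (tensor_sharp t).

Definition induced_form t x y : K := (tensor_sharp t)^-1%VF x y.

Lemma tensE x y xi eta : tens x y xi eta = xi x * eta y :> K.
Proof.
rewrite lfun2E //; split=> w a u v; rewrite add_lfunE scale_lfunE.
  by rewrite mulrDl -mulrA.
by rewrite mulrDr mulrCA.
Qed.

Lemma tensor_flipE t xi eta : tensor_flip t xi eta = t eta xi.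
Proof.
rewrite lfun2E //; split=> w a u v; first by rewrite linearP.
by rewrite linearP add_lfunE scale_lfunE.
Qed.

Lemma tensor_flip_tens x y : tensor_flip (tens x y) = tens y x.
Proof.
apply/lfunP => xi; apply/lfunP => eta.
by rewrite tensor_flipE !tensE mulrC.
Qed.

Lemma ev_dualE x xi : ev_dual x xi = xi x.
Proof.
rewrite lfun2E //; split=> w a u v; first by rewrite linearP.
by rewrite add_lfunE scale_lfunE.
Qed.

Lemma ev_dual_inj : lker ev_dual == 0%VS.
Proof.
apply/lker0P => x y exy; apply: dual_separates => xi.
by rewrite -!ev_dualE exy.
Qed.

Lemma ev_dual_surj : limg ev_dual = fullv.
Proof.
apply/eqP; rewrite eqEdim subvf /= limg_dim_eq ?(eqP ev_dual_inj) ?capv0 //.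
have dim_dual (V : vectType K) : dim (dual V) = dim V by exact: muln1.
by rewrite !dimvf !dim_dual.
Qed.

Lemma tensor_sharpE t xi eta : eta (tensor_sharp t xi) = t xi eta.
Proof.
rewrite comp_lfunE -ev_dualE.
by rewrite limg_lfunVK // ev_dual_surj memvf.
Qed.

Lemma tens_universal (W : vectType K) (f : {bilinear h -> h -> W}) :
  exists! F : 'Hom(tensor2 h, W), forall x y, F (tens x y) = f x y.
Proof.
pose b := vbasis {:h}; pose n := \dim {:h}.
pose c i : dual h := linfun (coord b i : h -> K^o).
have cE i x : c i x = coord b i x :> K by rewrite lfunE.
have decx x : x = \sum_(i < n) c i x *: b`_i.
  rewrite {1}(coord_vbasis (memvf x)).
  by apply: eq_bigr => i _; rewrite cE.
have decd xi : xi = \sum_(i < n) xi b`_i *: c i.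
  apply/lfunP => x; rewrite {1}(decx x) linear_sum sum_lfunE /=.
  by apply: eq_bigr => i _; rewrite linearZ scale_lfunE /= [LHS]mulrC.
have dect t : t = \sum_(i < n) \sum_(j < n) t (c i) (c j) *: tens b`_i b`_j.
  apply/lfunP => xi; apply/lfunP => eta.
  rewrite {1}(decd xi) linear_sum !sum_lfunE; apply: eq_bigr => i _ /=.
  rewrite linearZ scale_lfunE {1}(decd eta) linear_sum sum_lfunE scaler_sumr.
  rewrite sum_lfunE; apply: eq_bigr => j _ /=.
  rewrite linearZ 2!scale_lfunE tensE /=.
  by rewrite [LHS]mulrA [RHS]mulrC.
pose F0 t := \sum_(i < n) \sum_(j < n) t (c i) (c j) *: f b`_i b`_j.
have linF : linear F0.
  move=> a t u; rewrite /F0 scaler_sumr -big_split; apply: eq_bigr => i _ /=.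
  rewrite scaler_sumr -big_split; apply: eq_bigr => j _ /=.
  by rewrite !(add_lfunE, scale_lfunE) scalerDl scalerA.
exists (linfun F0); split=> [x y | G GE].
  rewrite (linfun_linearE linF) /F0 {2}(decx x) linear_sumlz.
  apply: eq_bigr => i _ /=.
  rewrite linearZl_LR {2}(decx y) linear_sumr scaler_sumr.
  apply: eq_bigr => j _ /=.
  by rewrite linearZr_LR scalerA tensE.
apply/lfunP => t; rewrite (linfun_linearE linF) {2}(dect t) linear_sum /=.
apply: eq_bigr => i _; rewrite linear_sum; apply: eq_bigr => j _ /=.
by rewrite linearZ /= GE.
Qed.

End Tensor.

Fact hom_expr_bilinear (K : fieldType) (U V : vectType K) (f k : U -> V)
    (L R : V -> U -> U) (b : V -> V -> V) :
    (forall a u v, f (a *: u + v) = a *: f u + f v) ->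
    (forall a u v, k (a *: u + v) = a *: k u + k v) ->
    (forall a x y u, L (a *: x + y) u = a *: L x u + L y u) ->
    (forall x a u v, L x (a *: u + v) = a *: L x u + L x v) ->
    (forall a x y u, R (a *: x + y) u = a *: R x u + R y u) ->
    (forall x a u v, R x (a *: u + v) = a *: R x u + R x v) ->
    (forall a x y z, b (a *: x + y) z = a *: b x z + b y z) ->
    (forall x a y z, b x (a *: y + z) = a *: b x y + b x z) ->
  bilinear_for *:%R *:%R (fun u v =>
    - f (L (k u) v) + f (L (k v) u) + f (R (k v) u) + b (k u) (f v)
    + b (f u) (k v) - k (L (f u) v) + k (L (f v) u) + k (R (f v) u)).
Proof.
move=> fP kP LlP LrP RlP RrP blP brP.
have addE (x y : V) (xi : dual V) : xi (x + y) = xi x + xi y :> K.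
  by rewrite linearD.
have oppE (x : V) (xi : dual V) : xi (- x) = - xi x :> K.
  by rewrite linearN.
have scE (a : K) (x : V) (xi : dual V) : xi (a *: x) = a * xi x :> K.
  by rewrite linearZ.
split=> u a v w; apply: dual_separates => xi.
  rewrite !(fP, kP) !LlP !LrP !RrP !blP !(fP, kP).
  by rewrite !(addE, oppE, scE); ring.
rewrite !(fP, kP) !LlP !LrP !RlP !brP !(fP, kP).
by rewrite !(addE, oppE, scE); ring.
Qed.

Section CLYBE.
Variables (K : fieldType) (h : vectType K) (g : leibnizAlgebra h).

Local Notation "[ x , y ]" := (lbracket g x y).
Local Notation Ls := (dual_rep (lmult (lbracket g))).
Local Notation Rs := (dual_rep (rmult (lbracket g))).

Definition hom_bracket (f k : 'Hom(dual h, h)) (xi1 xi2 : dual h) : h :=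
  - f (Ls (k xi1) xi2) + f (Ls (k xi2) xi1) + f (Rs (k xi2) xi1)
  + [k xi1, f xi2] + [f xi1, k xi2]
  - k (Ls (f xi1) xi2) + k (Ls (f xi2) xi1) + k (Rs (f xi2) xi1).

Fact hom_bracket_bilinear f k : bilinear_for *:%R *:%R (hom_bracket f k).
Proof.
apply: (hom_expr_bilinear (L := fun x => Ls x) (R := fun x => Rs x)
          (b := fun x y => [x, y])).
- by move=> a u v; rewrite linearP.
- by move=> a u v; rewrite linearP.
- move=> a x x' xi; apply/lfunP => y.
  rewrite add_lfunE scale_lfunE !dual_repE !lmultE linearPl linearP.
  by rewrite opprD scalerN.
- by move=> x a u v; rewrite linearP.
- move=> a x x' xi; apply/lfunP => y.
  rewrite add_lfunE scale_lfunE !dual_repE !rmultE linearPr linearP.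
  by rewrite opprD scalerN.
- by move=> x a u v; rewrite linearP.
- by move=> a x x' y; rewrite linearPl.
- by move=> x a y y'; rewrite linearPr.
Qed.

Definition tensor_bracket (P Q : tensor2 h) : tensor3 h :=
  lfun2 (fun xi1 xi2 =>
    ev_dual h (hom_bracket (tensor_sharp P) (tensor_sharp Q) xi1 xi2)).

Lemma tensor_bracketE P Q xi1 xi2 xi3 :
  tensor_bracket P Q xi1 xi2 xi3 =
  xi3 (hom_bracket (tensor_sharp P) (tensor_sharp Q) xi1 xi2).
Proof.
rewrite /tensor_bracket lfun2E ?ev_dualE //.
have [hbl hbr] :=
  hom_bracket_bilinear (tensor_sharp P) (tensor_sharp Q).
split=> u a v w; [rewrite hbl | rewrite hbr]; exact: linearP.
Qed.

Definition CLYBE (r : tensor2 h) := tensor_bracket r r = 0.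

End CLYBE.

(* Main.v *)
(** The tensor [r] is the inverse of the natural symmetric pairing
    [B (x + xi, y + eta) = <xi, y> + <eta, x>] on [A + A^*].  A symmetric tensor
    whose sharp map inverts a form [B] solves the classical Leibniz Yang-Baxter
    equation as soon as [B] satisfies
    [B([X,Y],Z) = - B(Y,[X,Z]) + B(X,[Y,Z]) + B(X,[Z,Y])], and for the
    semidirect product this identity is a direct expansion. *)
Require Import Defs.
From mathcomp Require Import all_boot all_order all_algebra.
From mathcomp Require Import ring.

Set Implicit Arguments.
Unset Strict Implicit.

Import GRing.Theory.
Local Open Scope ring_scope.

Section DualBasis.
Variables (K : fieldType) (A : vectType K) (n : nat).
Variables (e : n.-tuple A) (estar : n.-tuple (dual A)).
Hypothesis basis_e : basis_of {:A} e.
Hypothesis dual_e :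
  forall i j : 'I_n, tnth estar i (tnth e j) = (i == j)%:R.

(** Applying [tnth estar i] to the expansion of [x] in [e] leaves only the [i]-th coordinate, by
    duality. *)
Lemma dual_basis_vec (x : A) :
  x = \sum_(i < n) (tnth estar i x : K) *: tnth e i.
Proof.
rewrite {1}(coord_basis basis_e (memvf x)); apply: eq_bigr => i _.
rewrite -tnth_nth; congr (_ *: _).
rewrite {2}(coord_basis basis_e (memvf x)) linear_sum (bigD1 i) //=.
rewrite big1 => [|j ij].
  by rewrite addr0 linearZ -tnth_nth /= dual_e eqxx [RHS]mulr1.
by rewrite linearZ -tnth_nth /= dual_e eq_sym (negPf ij) [LHS]mulr0.
Qed.

Lemma dual_basis_form (xi : dual A) :
  xi = \sum_(i < n) (xi (tnth e i) : K) *: tnth estar i.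
Proof.
apply/lfunP => x; rewrite {1}(dual_basis_vec x) linear_sum sum_lfunE /=.
by apply: eq_bigr => i _; rewrite linearZ scale_lfunE /= [LHS]mulrC.
Qed.

End DualBasis.

Section Pairing.
Variables (K : fieldType) (A : vectType K).
Local Notation h := (A * dual A)%type.

Definition dual_pairing : 'Hom(h, dual h) :=
  lfun2 (fun X Y : h => X.2 Y.1 + Y.2 X.1 : K^o).

Lemma dual_pairingE (X Y : h) : dual_pairing X Y = X.2 Y.1 + Y.2 X.1 :> K.
Proof.
rewrite lfun2E //; split=> W a U V /=;
  rewrite !linearP !add_lfunE !scale_lfunE scalerDr; exact: addrACA.
Qed.

(** The brackets of [Y] and [Z] in both orders supply the [X.2] terms; their surplus, and all stray
    values of [Y.2] and [Z.2], cancel in the sum. *)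
Lemma dual_pairing_invariant (D : leibnizDendriform A) (X Y Z : h) :
  dual_pairing (ld_double_bracket D X Y) Z =
  - dual_pairing Y (ld_double_bracket D X Z)
  + dual_pairing X (ld_double_bracket D Y Z)
  + dual_pairing X (ld_double_bracket D Z Y) :> K.
Proof.
have addE (xi : dual A) u v : xi (u + v) = xi u + xi v :> K.
  by rewrite linearD.
rewrite !dual_pairingE !ld_double_bracket2E !ld_double_bracket1E !ld_bracketE.
by rewrite !addE; ring.
Qed.

End Pairing.

(** With both maps equal to the sharp map, [hom_bracket] collapses to twice [[X,Y] - P + Q + S], so
    a single identity for [[X,Y]] suffices. *)
Lemma CLYBE_of_form (K : fieldType) (h : vectType K) (g : leibnizAlgebra h)
    (r : tensor2 h) (b : 'Hom(h, dual h)) :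
    cancel b (tensor_sharp r) -> cancel (tensor_sharp r) b ->
    (forall X Y Z : h, b (lbracket g X Y) Z =
       - b Y (lbracket g X Z) + b X (lbracket g Y Z)
       + b X (lbracket g Z Y) :> K) ->
  CLYBE g r.
Proof.
move=> bK sK binv; apply/lfunP => xi1; apply/lfunP => xi2; apply/lfunP => xi3.
rewrite tensor_bracketE !zero_lfunE.
suff -> : hom_bracket g (tensor_sharp r) (tensor_sharp r) xi1 xi2 = 0.
  by rewrite linear0.
rewrite /hom_bracket.
set X := tensor_sharp r xi1; set Y := tensor_sharp r xi2.
set P := tensor_sharp r (dual_rep _ X xi2).
set Q := tensor_sharp r (dual_rep (lmult _) Y xi1).
set S := tensor_sharp r (dual_rep (rmult _) Y xi1).
(* Under the injective [b] this becomes an equality of forms. At [Z] it is [binv], since [b X] is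
   [xi1], [b Y] is [xi2], and each [dual_rep] brings a sign. *)
have -> : lbracket g X Y = P - Q - S.
  apply: (can_inj bK); rewrite !linearB /= !sK; apply/lfunP => Z.
  rewrite !(add_lfunE, opp_lfunE) !dual_repE !lmultE rmultE !opprK.
  by rewrite binv !sK.
(* Testing against [xi] moves the cancellation into [K], where [ring] applies. *)
apply: dual_separates => xi; rewrite !(linearD, linearB, linearN) linear0 /=.
ring.
Qed.

Section CanonicalTensor.
Variables (K : fieldType) (A : vectType K) (n : nat).
Variables (e : n.-tuple A) (estar : n.-tuple (dual A)).
Hypothesis basis_e : basis_of {:A} e.
Hypothesis dual_e :
  forall i j : 'I_n, tnth estar i (tnth e j) = (i == j)%:R.
Local Notation h := (A * dual A)%type.

Definition canonical_tensor : tensor2 h := \sum_(i < n)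
  (tens (0, tnth estar i) (tnth e i, 0) + tens (tnth e i, 0) (0, tnth estar i)).

Lemma canonical_tensor_sym : symmetric_tensor canonical_tensor.
Proof.
apply/lfunP => xi; apply/lfunP => eta; rewrite tensor_flipE !sum_lfunE.
apply: eq_bigr => i _; rewrite !add_lfunE !tensE addrC.
by congr (_ + _); rewrite mulrC.
Qed.

(** Brings vectors of the double to the single-sum shape of [canonical_tensor], so that later sums
    compare term by term. *)
Lemma pair_sum (c d : 'I_n -> K) :
  (\sum_(i < n) c i *: tnth e i, \sum_(i < n) d i *: tnth estar i) =
  \sum_(i < n) (c i *: ((tnth e i, 0) : h) + d i *: ((0, tnth estar i) : h)).
Proof.
apply: (big_ind3 (fun u v w => (u, v) = w)) => [//|? ? ? ? ? ? <- <- //|i _].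
by congr pair; rewrite /= scaler0 ?addr0 ?add0r.
Qed.

(** The sharp map exchanges the two halves: values of [zeta] on [dual A] become coordinates in [A],
    and conversely. *)
Lemma canonical_sharpE (zeta : dual h) :
  tensor_sharp canonical_tensor zeta =
  (\sum_(i < n) (zeta (0, tnth estar i) : K) *: tnth e i,
   \sum_(i < n) (zeta (tnth e i, 0) : K) *: tnth estar i).
Proof.
rewrite pair_sum; apply: dual_separates => eta.
rewrite tensor_sharpE !sum_lfunE linear_sum /=; apply: eq_bigr => i _.
by rewrite !add_lfunE !tensE linearD !linearZ.
Qed.

(** The values of [dual_pairing (x, xi)] on the basis vectors of the double are the coordinates of
    [x] and [xi] in the dual bases. *)
Lemma dual_pairingK :
  cancel (@dual_pairing K A) (tensor_sharp canonical_tensor).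
Proof.
case=> x xi; rewrite canonical_sharpE [in RHS](dual_basis_vec basis_e dual_e x).
rewrite [in RHS](dual_basis_form basis_e dual_e xi); congr pair;
  apply: eq_bigr => i _; rewrite dual_pairingE /=.
  by rewrite linear0 add0r.
by rewrite zero_lfunE addr0.
Qed.

Lemma canonical_sharpK :
  cancel (tensor_sharp canonical_tensor) (@dual_pairing K A).
Proof.
move=> zeta; rewrite canonical_sharpE; apply/lfunP => -[y eta].
rewrite dual_pairingE /=.
(* Here the argument [(y, eta)] of [zeta] is expanded, and linearity of [zeta] does the rest. *)
rewrite [in RHS](dual_basis_vec basis_e dual_e y).
rewrite [in RHS](dual_basis_form basis_e dual_e eta) pair_sum.
rewrite sum_lfunE !linear_sum -big_split; apply: eq_bigr => i _ /=.
rewrite scale_lfunE linearD !linearZ /=.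
by congr (_ + _); exact: mulrC.
Qed.

End CanonicalTensor.

Theorem theorem5p9 (K : closedFieldType) (A : vectType K)
    (D : leibnizDendriform A) (n : nat)
    (e : n.-tuple A) (estar : n.-tuple (dual A)) :
  [pchar K] =i pred0 ->
  basis_of {:A} e ->
  (forall i j : 'I_n, tnth estar i (tnth e j) = (i == j)%:R) ->
  let r := \sum_(i < n)
    (tens (0, tnth estar i) (tnth e i, 0) +
     tens (tnth e i, 0) (0, tnth estar i)) in
  [/\ symmetric_tensor r,
      CLYBE (ld_semidirect D) r,
      nondegenerate_tensor r
    & forall (x y : A) (xi eta : dual A),
        induced_form r (x, xi) (y, eta) = xi y + eta x].
Proof.
move=> _ basis_e dual_e r.
have bK : cancel _ (tensor_sharp r) := dual_pairingK basis_e dual_e.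
have sK : cancel (tensor_sharp r) _ := canonical_sharpK basis_e dual_e.
split; first exact: canonical_tensor_sym.
- by apply: CLYBE_of_form bK sK _; exact: dual_pairing_invariant.
- by exists (@dual_pairing K A).
(* Writing [(x, xi)] as a value of the sharp map lets the formal inverse cancel, which requires the
   trivial kernel given by [sK]. *)
move=> x y xi eta; rewrite /induced_form -{1}(bK (x, xi)).
rewrite lker0_lfunK; first exact: dual_pairingE.
by apply/lker0P; exact: can_inj sK.
Qed.
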